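(* Let $K$ be a field, $S=K[x_1,\dots,x_n]$, and let $I\subseteq S$ be a right PLP-polymatroidal ideal with data $k$, $d$, $\alpha_1,\dots,\alpha_k$, $\beta_1,\dots,\beta_k$, $b_{k+1},\dots,b_n$. Let $\mathbf b([k+1,n])=b_{k+1}+\cdots+b_n$ and $\delta=\lfloor\frac{\alpha_k}{\beta_k}\rfloor$. (a) If $d=\beta_k+\mathbf b([k+1,n])$, then $\operatorname{astab}(I)=1$. (b) If $d<\beta_k+\mathbf b([k+1,n])$, then $\operatorname{astab}(I)=\Big\lceil\frac{n-k-\delta}{\beta_k+\mathbf b([k+1,n])-d}\Big\rceil$.
   Context: $\lfloor a\rfloor$ and $\lceil a\rceil$ denote the lower and upper integer part of a real number $a$. For a monomial ideal $I\subseteq S$, $\operatorname{astab}(I)$ is the smallest integer $m$ with the property that $\operatorname{Ass}(S/I^m)=\operatorname{Ass}(S/I^\ell)$ for all $\ell\ge m$. Right PLP-polymatroidal ideal: let $n,k,d$ be positive integers with $1\le k\le n-1$, let $\alpha_i,\beta_i$ $(1\le i\le k)$ be non-negative integers with $\alpha_i\le\beta_i$ for all $i$, $\alpha_1\le\cdots\le\alpha_k\le d$, $0<\beta_1\le\cdots\le\beta_k\le d$, and let $b_{k+1},\dots,b_n$ be positive integers with $d\le\beta_k+b_{k+1}+\cdots+b_n$. The corresponding right PLP-polymatroidal ideal $I$ is the (nonzero) monomial ideal of $S$ generated by all $x_1^{u_1}\cdots x_n^{u_n}$, with $u_i$ non-negative integers, such that $\alpha_i\le u_1+\cdots+u_i\le\beta_i$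 for $i=1,\dots,k$, $0\le u_i\le b_i$ for $i=k+1,\dots,n$, and $u_1+\cdots+u_n=d$.
   Formalization: In (b) the value is max(1, ⌈(n−k−δ)/(β_k+b([k+1,n])−d)⌉): when n=k+1 and α_k=β_k the printed formula gives 0, but astab(I)=1 (e.g. n=2, k=d=α_1=β_1=b_2=1, I=(x_1)). *)

(* Defs.v *)
From mathcomp Require Import all_boot all_order all_algebra.
From mathcomp Require Import classical_sets.
From mathcomp Require Import mpoly.

Set Implicit Arguments.
Unset Strict Implicit.
Unset Printing Implicit Defensive.

Import GRing.Theory.

Local Open Scope ring_scope.
Local Open Scope classical_set_scope.

Section Ideals.
Variable R : comNzRingType.
Implicit Types I J P G : set R.

(* [MathComp]'s own ideal predicates are about boolean collections; here ideals
   are arbitrary sets, since membership in an ideal is not decidable a priori. *)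
Definition is_ideal I : Prop :=
  [/\ I 0, (forall a b, I a -> I b -> I (a + b)) & (forall a b, I b -> I (a * b))].

Definition is_prime_ideal P : Prop :=
  [/\ is_ideal P, ~ P 1 & forall a b, P (a * b) -> P a \/ P b].

Definition ideal_span G : set R :=
  [set f | exists (m : nat) (c g : 'I_m -> R),
             (forall i, G (g i)) /\ f = \sum_(i < m) c i * g i].

(* For [m = 0] this is the unit ideal. *)
Definition ideal_pow I (m : nat) : set R :=
  ideal_span [set f | exists g : 'I_m -> R,
                        (forall i, I (g i)) /\ f = \prod_(i < m) g i].

(* The annihilator of the class of [f] in the module [R / J]. *)
Definition colon J (f : R) : set R := [set g | J (g * f)].

(* Ass(R / J) *)
Definition Ass J : set (set R) :=
  [set P | is_prime_ideal P /\ exists f, P = colon J f].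

(* As usual for powers of ideals, exponents are positive. *)
Definition Ass_stable_from I (m : nat) : Prop :=
  (0 < m)%N /\
  forall l, (m <= l)%N -> Ass (ideal_pow I m) = Ass (ideal_pow I l).

(* [is_astab I m] states astab(I) = m; in particular it contains the assertion
   that the sets of associated primes do stabilize. The value is always at
   least 1: for n = 2 and I = (x_1) it is 1, although with k = d = alpha_1 =
   beta_1 = b_2 = 1 the quotient (n - k - delta) / (beta_k + b_2 - d) is 0. *)
Definition is_astab I (m : nat) : Prop :=
  Ass_stable_from I m /\ forall m', Ass_stable_from I m' -> (m <= m')%N.

End Ideals.

(* [alpha], [beta] and [b] are indexed from 1 as in the usual notation: only
   [alpha i], [beta i] for [1 <= i <= k] and [b i] for [k + 1 <= i <= n] are
   meaningful. *)
Definition bsum (b : nat -> nat) (k n : nat) : nat :=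
  (\sum_(k.+1 <= i < n.+1) b i)%N.

Record right_PLP_data (n k d : nat) (alpha beta b : nat -> nat) : Prop :=
  RightPLPData {
    plp_k_gt0 : (1 <= k)%N;
    plp_k_lt : (k <= n - 1)%N;
    plp_d_gt0 : (0 < d)%N;
    plp_alpha_beta : forall i, (1 <= i <= k)%N -> (alpha i <= beta i)%N;
    plp_alpha_mono :
      forall i j, (1 <= i)%N -> (i <= j <= k)%N -> (alpha i <= alpha j)%N;
    plp_alpha_d : (alpha k <= d)%N;
    plp_beta_gt0 : (0 < beta 1)%N;
    plp_beta_mono :
      forall i j, (1 <= i)%N -> (i <= j <= k)%N -> (beta i <= beta j)%N;
    plp_beta_d : (beta k <= d)%N;
    plp_b_gt0 : forall i, (k < i <= n)%N -> (0 < b i)%N;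
    plp_d_le : (d <= beta k + bsum b k n)%N
  }.

(* The exponent of the variable x_i (1 <= i <= n) in the multi-index [u] is
   [u j], where [j : 'I_n] has value [i - 1]. *)
Definition right_PLP_exponent (n k d : nat) (alpha beta b : nat -> nat)
    (u : 'X_{1..n}) : Prop :=
  [/\ forall i, (1 <= i <= k)%N ->
        (alpha i <= \sum_(j < n | (j < i)%N) u j <= beta i)%N,
      forall j : 'I_n, (k < j.+1)%N -> (u j <= b j.+1)%N
    & (\sum_(j < n) u j)%N = d].

Definition right_PLP_ideal (K : fieldType) (n k d : nat)
    (alpha beta b : nat -> nat) : set {mpoly K[n]} :=
  ideal_span [set f | exists u : 'X_{1..n},
                        right_PLP_exponent k d alpha beta b u /\ f = 'X_[u]].

Arguments right_PLP_ideal : clear implicits.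

(* Main.v *)
(** Put beta_0 = 0. Rounding prefix sums shows that a lattice point of the s-th
dilate of the defining polytope is a sum of s lattice points of the polytope,
so I^s is the right PLP-polymatroidal ideal with all data multiplied by s. The
greedy choice of prefix sums describes the monomials x^v of such an ideal by
the inequalities v_{j+1} + ... + v_t >= alpha_t - beta_j (0 <= j < t <= k) and
v_{j+1} + ... + v_k + sum_{i > k} min(v_i, b_i) >= d - beta_j (0 <= j <= k).

The associated primes of a monomial ideal are the primes (x_i : i in B) for
which some monomial outside the ideal, even after multiplication by variables
outside B, enters it after multiplication by any variable of B. By the above
inequalities either B = [j+1, t], or B = [j+1, k] together with a nonempty set A
of indices > k. The conditions on B are homogeneous in the data, hence the same
for all powers, except for one: |A| <= s (beta_k + b([k+1, n]) - d) + [j = k].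
So Ass(S/I^s) is determined by which sets A it allows; the last one to enter
is A = [k+1, n], with j = k if alpha_k = beta_k, and otherwise with the largest
j such that beta_j < beta_k. *)
Require Import Defs.
From mathcomp Require Import all_boot all_order all_algebra.
From mathcomp Require Import boolp classical_sets.
From mathcomp Require Import mpoly.
From mathcomp Require Import zify ring.

Set Implicit Arguments.
Unset Strict Implicit.
Unset Printing Implicit Defensive.

Import Order.TTheory GRing.Theory Num.Theory.

Local Open Scope ring_scope.

(** * Monomial ideals and their associated primes *)

Section MonomialIdeals.
Variables (K : fieldType) (n : nat).
Implicit Types (M : 'X_{1..n} -> Prop) (v w : 'X_{1..n}) (B : pred nat).
Implicit Types (f g : {mpoly K[n]}).

Definition mon_ideal M : set {mpoly K[n]} :=
  [set f | forall v, v \in msupp f -> M v].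

Definition upclosed M := forall v w, M v -> M (w + v)%MM.

Definition mon_part M f : {mpoly K[n]} :=
  \sum_(v <- msupp f) (if `[< M v >] then f@_v *: 'X_[v] else 0).

Lemma mcoeff_mon_part M f v :
  (mon_part M f)@_v = if `[< M v >] then f@_v else 0.
Proof.
rewrite /mon_part raddf_sum /=.
have [vf|vf] := boolP (v \in msupp f); last first.
  rewrite (memN_msupp_eq0 vf) if_same big1_seq // => w /andP[_ wf].
  case: ifP => _; last by rewrite mcoeff0.
  rewrite mcoeffZ mcoeffX; case: eqP => [wv|_]; last by rewrite mulr0.
  by rewrite wv (negbTE vf) in wf.
rewrite (bigD1_seq v) ?msupp_uniq //= big1 ?addr0 => [|w wv].
  by case: ifP => _; rewrite ?mcoeff0 // mcoeffZ mcoeffX eqxx mulr1.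
by case: ifP => _; rewrite ?mcoeff0 // mcoeffZ mcoeffX (negbTE wv) mulr0.
Qed.

Lemma mon_part_supp M f v : v \in msupp (mon_part M f) -> M v /\ v \in msupp f.
Proof.
rewrite mcoeff_msupp mcoeff_mon_part; case: asboolP => [Mv|_].
  by rewrite -mcoeff_msupp.
by rewrite eqxx.
Qed.

Lemma mon_part_split M f :
  f = mon_part M f + mon_part (fun v => ~ M v) f.
Proof.
apply/mpolyP => v; rewrite mcoeffD !mcoeff_mon_part.
by case: asboolP => Mv; case: asboolP => nMv; rewrite ?addr0 ?add0r.
Qed.

Lemma mon_idealD M f g : mon_ideal M f -> mon_ideal M g -> mon_ideal M (f + g).
Proof.
by move=> Mf Mg v /msuppD_le; rewrite mem_cat => /orP[/Mf|/Mg].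
Qed.

Lemma mon_idealN M f : mon_ideal M f -> mon_ideal M (- f).
Proof. by move=> Mf v; rewrite (perm_mem (msuppN f)) => /Mf. Qed.

Lemma mon_idealM M f g : upclosed M -> mon_ideal M g -> mon_ideal M (f * g).
Proof.
by move=> Mup Mg v /msuppM_le/allpairsP[[a b] /= [_ /Mg Mb ->]]; apply: Mup.
Qed.

Lemma mon_ideal_is_ideal M : upclosed M -> is_ideal (mon_ideal M).
Proof.
move=> Mup; split; first by move=> v; rewrite msupp0.
- exact: mon_idealD.
- by move=> f g; apply: mon_idealM.
Qed.

Lemma mon_idealX M v : mon_ideal M 'X_[v] <-> M v.
Proof.
split=> [|Mv w]; first by apply; rewrite msuppX mem_seq1.
by rewrite msuppX mem_seq1 => /eqP->.
Qed.

Definition meets B v := exists2 i : 'I_n, B i & (0 < v i)%N.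

Lemma upclosed_meets B : upclosed (meets B).
Proof. by move=> v w [i Bi vi]; exists i => //; rewrite mnmDE addn_gt0 vi orbT. Qed.

Lemma meetsD B v w : meets B (v + w)%MM -> meets B v \/ meets B w.
Proof.
by case=> i Bi; rewrite mnmDE addn_gt0 => /orP[vi|wi]; [left|right]; exists i.
Qed.

(** The prime (x_i : i in [B]). [B] is a predicate on [nat], so that the combinatorial part can do
    without ordinals; only its values below [n] matter. *)
Definition mon_prime B : set {mpoly K[n]} := mon_ideal (meets B).

Lemma mon_primeX B (i : 'I_n) : mon_prime B 'X_i <-> B i.
Proof.
rewrite /mon_prime mon_idealX; split=> [[j Bj]|Bi]; last first.
  by exists i; rewrite // mnm1E eqxx.
by rewrite mnm1E; case: eqP => // ->.
Qed.

(** From two factors outside the ideal, discard the terms lying in it. What remains is nonzero and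
    avoids the variables of [B]; so does the leading monomial of the product of the two remainders,
    which is therefore not in the ideal. *)
Lemma mon_primeP B : is_prime_ideal (mon_prime B).
Proof.
split; first exact: mon_ideal_is_ideal (@upclosed_meets B).
  by move=> /(_ 0%MM); rewrite msupp1 mem_seq1 eqxx => /(_ isT)[i _]; rewrite mnm0E.
pose out f := mon_part (fun v => ~ meets B v) f.
have outE f : ~ mon_prime B f -> out f != 0.
  move=> nPf; apply/eqP => f0; apply: nPf.
  rewrite (mon_part_split (meets B) f) -/(out f) f0 addr0.
  by move=> v /mon_part_supp[].
have inP f : mon_prime B (mon_part (meets B) f) by move=> v /mon_part_supp[].
move=> f g Pfg; apply: contrapT => /not_orP[/outE f0 /outE g0].
have Pout : mon_prime B (out f * out g).
  have -> : out f * out g = f * g + - (mon_part (meets B) f * g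
      + out f * mon_part (meets B) g).
    have fE := mon_part_split (meets B) f; have gE := mon_part_split (meets B) g.
    rewrite -/(out f) in fE; rewrite -/(out g) in gE.
    transitivity ((mon_part (meets B) f + out f) * (mon_part (meets B) g + out g)
        + - (mon_part (meets B) f * (mon_part (meets B) g + out g)
             + out f * mon_part (meets B) g)); first by ring.
    by rewrite -fE -gE.
  apply: mon_idealD => //; apply: mon_idealN; apply: mon_idealD.
    by rewrite mulrC; apply: mon_idealM (inP _); apply: upclosed_meets.
  by apply: mon_idealM (inP _); apply: upclosed_meets.
have /Pout : mlead (out f * out g) \in msupp (out f * out g).
  by rewrite mlead_supp // mulf_neq0.
rewrite mleadM // => /meetsD[].
  by case/mon_part_supp: (mlead_supp f0).
by case/mon_part_supp: (mlead_supp g0).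
Qed.

(* The primes of Ass are encoded by sets of variables; [v] is the exponent of a
   monomial whose annihilator modulo the ideal is the prime of [B]. *)
Definition mon_assoc M B := exists v,
  (forall w, (forall i : 'I_n, B i -> w i = 0%N) -> ~ M (w + v)%MM) /\
  (forall i : 'I_n, B i -> M (U_(i) + v)%MM).

Lemma mon_assoc_Ass M B : upclosed M -> mon_assoc M B -> Ass (mon_ideal M) (mon_prime B).
Proof.
move=> Mup [v [vout vin]]; split; first exact: mon_primeP.
exists 'X_[v]; apply/seteqP; split=> f /= Pf w.
  rewrite /colon (perm_mem (msuppMX f v)) => /mapP[u uf ->].
  have [i Bi ui] := Pf _ uf.
  have -> : (v + u = (u - U_(i)) + (U_(i) + v))%MM.
    apply/mnmP => j; rewrite !mnmDE mnmBE mnm1E.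
    by case: eqP => [<-|_] /=; lia.
  exact/Mup/vin.
move=> wf; apply: contrapT => nw; apply: (vout w) => [i Bi|].
  by apply/eqP; rewrite -leqn0 leqNgt; apply/negP => wi; apply: nw; exists i.
apply: (Pf); rewrite mcoeff_msupp addmC mcoeffMX -mcoeff_msupp //.
Qed.

(** [B] collects the variables in P = (M : f). The terms of f that monomials off [B] move into the
    ideal can be removed by a single such monomial; the rest [f0] is nonzero because P contains no
    monomial off [B]. The leading exponent of [f0] is the witness, and splitting g in P in a similar
    way shows that every term of g meets [B]. *)
Lemma Ass_mon_assoc M P : upclosed M -> Ass (mon_ideal M) P ->
  exists2 B, P = mon_prime B & mon_assoc M B.
Proof.
move=> Mup [[[P0 PD PM] P1 Pprime] [f Pf]].
pose B x := `[< exists2 i : 'I_n, i = x :> nat & P 'X_i >].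
have BE (i : 'I_n) : B i <-> P 'X_i.
  split=> [/asboolP[j /val_inj->//]|Pi]; by apply/asboolP; exists i.
pose off w := forall i : 'I_n, B i -> w i = 0%N.
have PX w : P 'X_[w] -> ~ off w.
  suff H s : P (\prod_(i <- s) 'X_i ^+ w i) -> exists2 i : 'I_n, B i & (0 < w i)%N.
    by rewrite mpolyXE_id => /H[i /[swap] wi Bi /(_ i Bi) w0]; rewrite w0 in wi.
  elim: s => [|i s IHs]; first by rewrite big_nil => /P1.
  have PXn l : P ('X_i ^+ l) -> (0 < l)%N /\ B i.
    elim: l => [|l IHl]; first by rewrite expr0 => /P1.
    by rewrite exprS => /Pprime[/BE|/IHl[]].
  by rewrite big_cons => /Pprime[/PXn[wi Bi]|/IHs//]; exists i.
pose M' v := exists2 w, off w & M (w + v)%MM.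
(* One multiplier serves finitely many terms: the product of their individual multipliers, since [M]
   is up-closed. *)
have M'M f1 : (forall v, v \in msupp f1 -> M' v) ->
    exists2 w, off w & mon_ideal M ('X_[w] * f1).
  move=> Hf1.
  suff [w ow Hw] : exists2 w, off w & forall v, v \in msupp f1 -> M (w + v)%MM.
    exists w => // u; rewrite mulrC (perm_mem (msuppMX _ _)) => /mapP[v vf ->].
    exact: Hw.
  elim: (msupp f1) Hf1 => [|v s IHs] Hs.
    by exists 0%MM => // i _; rewrite mnm0E.
  have [|w ow Hw] := IHs; first by move=> u us; apply: Hs; rewrite inE us orbT.
  have [w' ow' Hw'] := Hs v (mem_head _ _).
  exists (w + w')%MM => [i Bi|u]; first by rewrite mnmDE ow ?ow'.
  rewrite inE => /orP[/eqP->|/Hw Mu]; first by rewrite -addmA; apply: Mup.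
  by rewrite (addmC w) -addmA; apply: Mup.
pose f0 := mon_part (fun v => ~ M' v) f.
have f0E v : v \in msupp f0 -> ~ M' v /\ v \in msupp f by exact: mon_part_supp.
have f0N0 : f0 != 0.
  apply/eqP => f00; have [|w ow Hw] := M'M f.
    move=> v; rewrite (mon_part_split M' f) -/f0 f00 addr0.
    by case/mon_part_supp.
  by apply: (PX w) => //; rewrite Pf.
have inP i : B i -> forall v, v \in msupp f ->
    forall j : 'I_n, j = i :> nat -> M (U_(j) + v)%MM.
  move=> Bi v vf j ji; move: Bi; rewrite -ji => /BE; rewrite Pf => /(_ (v + U_(j))%MM).
  by rewrite addmC mulrC; apply; rewrite mcoeff_msupp mcoeffMX -mcoeff_msupp.
exists B; last first.
  exists (mlead f0); have [nM' lf] := f0E _ (mlead_supp f0N0).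
  split=> [w ow Mw|i Bi]; first by apply: nM'; exists w.
  exact: (inP i).
have PB g : mon_prime B g -> P g.
  move=> Bg; rewrite (mpolyE g) big_seq; elim/big_rec: _ => // v h vg Ph.
  apply: PD => //; have [i Bi vi] := Bg _ vg.
  have -> : v = ((v - U_(i)) + U_(i))%MM.
    by rewrite submK //; apply/mnm_lepP => j; rewrite mnm1E; case: eqP => // <-.
  by rewrite mpolyXD scalerAl; apply: PM; apply/BE.
apply/seteqP; split=> g Pg; last exact: PB.
pose g0 := mon_part (fun v => ~ meets B v) g.
have g1P : P (mon_part (meets B) g) by apply: PB => v /mon_part_supp[].
have [g00|g0N0] := eqVneq g0 0.
  by rewrite (mon_part_split (meets B) g) -/g0 g00 addr0 => v /mon_part_supp[].
have Pg0 : P g0.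
  have -> : g0 = g + (-1) * mon_part (meets B) g.
    have gE := mon_part_split (meets B) g; rewrite -/g0 in gE.
    transitivity (mon_part (meets B) g + g0 + (-1) * mon_part (meets B) g).
      by ring.
    by rewrite -gE.
  by apply: PD => //; apply: PM.
have [h hE] : exists h, f = f0 + h /\ forall v, v \in msupp h -> M' v.
  exists (mon_part M' f); split; last by move=> v /mon_part_supp[].
  by rewrite addrC -mon_part_split.
have [w ow Hw] := M'M h hE.2.
(* Here f0 = f - h, and x^w takes h into the ideal. The leading exponent of x^w g0 f0 then shows
   that a monomial off [B] moves the leading term of [f0] into the ideal, against the choice of
   [f0]. *)
have Mgf0 : mon_ideal M ('X_[w] * (g0 * f0)).
  have -> : 'X_[w] * (g0 * f0) = 'X_[w] * (g0 * f) + (- g0) * ('X_[w] * h).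
    by rewrite hE.1; ring.
  apply: mon_idealD; last exact: mon_idealM.
  by apply: mon_idealM => //; move: Pg0; rewrite Pf.
have [nM' _] := f0E _ (mlead_supp f0N0).
case: nM'; exists (w + mlead g0)%MM.
  move=> i Bi; rewrite mnmDE ow // add0n; apply/eqP; rewrite -leqn0 leqNgt.
  have [nm _] := mon_part_supp (mlead_supp g0N0).
  by apply/negP => gi; apply: nm; exists i.
apply: Mgf0; rewrite -addmA -mleadM // [_ * (_ * _)]mulrC mcoeff_msupp mcoeffMX -mcoeff_msupp.
by rewrite mlead_supp // mulf_neq0.
Qed.

Lemma mon_prime_inj B B' : mon_prime B = mon_prime B' -> forall i : 'I_n, B i = B' i.
Proof.
move=> BB' i; have [h1 h2] := mon_primeX B i; have [h3 h4] := mon_primeX B' i.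
by rewrite BB' in h1 h2; apply/idP/idP => [/h2/h3|/h4/h1].
Qed.

End MonomialIdeals.

(** * Generators and powers of monomial ideals *)

Section IdealSpan.
Variable R : comNzRingType.
Implicit Types (G J : set R).

Lemma ideal_span_incl G f : G f -> ideal_span G f.
Proof.
by move=> Gf; exists 1%N, (fun=> 1), (fun=> f); split=> //; rewrite big_ord1 mul1r.
Qed.

Lemma ideal_span_is_ideal G : is_ideal (ideal_span G).
Proof.
split.
- by exists 0%N, (fun=> 0), (fun=> 0); split; [case|rewrite big_ord0].
- move=> _ _ [m1 [c1 [g1 [G1 ->]]]] [m2 [c2 [g2 [G2 ->]]]].
  pose glue T (h1 : 'I_m1 -> T) (h2 : 'I_m2 -> T) (i : 'I_(m1 + m2)) :=
    match split i with inl j => h1 j | inr j => h2 j end.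
  exists (m1 + m2)%N, (glue _ c1 c2), (glue _ g1 g2); split.
    by move=> i; rewrite /glue; case: split.
  rewrite big_split_ord /glue /=; congr (_ + _); apply: eq_bigr => i _.
    by rewrite (unsplitK (inl _ i)).
  by rewrite (unsplitK (inr _ i)).
- move=> a _ [m [c [g [Gg ->]]]]; exists m, (fun i => a * c i), g; split=> //.
  by rewrite mulr_sumr; apply: eq_bigr => i _; rewrite mulrA.
Qed.

Lemma ideal_sum J (I : Type) (r : seq I) (F : I -> R) :
  is_ideal J -> (forall i, J (F i)) -> J (\sum_(i <- r) F i).
Proof. by case=> J0 JD _ JF; elim/big_ind: _. Qed.

Lemma ideal_span_sub G J : is_ideal J -> (forall f, G f -> J f) ->
  forall f, ideal_span G f -> J f.
Proof.
move=> Jid GJ _ [m [c [g [Gg ->]]]]; apply: ideal_sum => // i.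
by case: Jid => _ _ JM; apply/JM/GJ.
Qed.

End IdealSpan.

Section MonomialPowers.
Variables (K : fieldType) (n : nat).
Implicit Types (G M : 'X_{1..n} -> Prop) (u v w : 'X_{1..n}).

Lemma mon_ideal_sub M (J : set {mpoly K[n]}) : is_ideal J ->
  (forall v, M v -> J 'X_[v]) -> forall f, mon_ideal M f -> J f.
Proof.
move=> [J0 JD JM] MJ f Mf; rewrite (mpolyE f) big_seq.
elim/big_rec: _ => // v h /Mf Mv Jh; apply: JD => //.
by rewrite -mul_mpolyC; apply/JM/MJ.
Qed.

Lemma mon_ideal_span G :
  ideal_span [set f : {mpoly K[n]} | exists u, G u /\ f = 'X_[u]] =
  mon_ideal (fun v => exists2 u, G u & (u <= v)%MM).
Proof.
have up : upclosed (fun v => exists2 u, G u & (u <= v)%MM).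
  move=> v w [u Gu /mnm_lepP uv]; exists u => //; apply/mnm_lepP => i.
  by rewrite mnmDE (leq_trans (uv i)) ?leq_addl.
apply/seteqP; split=> f.
  apply: ideal_span_sub => [|_ [u [Gu ->]]]; first exact: mon_ideal_is_ideal.
  by apply/mon_idealX; exists u => //; apply: lepm_refl.
apply: mon_ideal_sub => [|v [u Gu uv]]; first exact: ideal_span_is_ideal.
rewrite -(submK uv) mpolyXD; have [_ _ spanM] := ideal_span_is_ideal
  [set f : {mpoly K[n]} | exists u, G u /\ f = 'X_[u]].
by apply/spanM/ideal_span_incl; exists u.
Qed.

Lemma msupp_prod m (g : 'I_m -> {mpoly K[n]}) v :
  v \in msupp (\prod_(i < m) g i) ->
  exists2 vs : 'I_m -> 'X_{1..n},
    (forall i, vs i \in msupp (g i)) & v = (\sum_i vs i)%MM.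
Proof.
elim: m g v => [|m IHm] g v.
  rewrite big_ord0 msupp1 mem_seq1 => /eqP->; exists (fun=> 0%MM); first by case.
  by rewrite big_ord0.
rewrite big_ord_recl => /msuppM_le/allpairsP[[a c] /= [ga /IHm[vs gvs ->] ->]].
exists (fun i => oapp vs a (unlift ord0 i)) => [i|].
  by case: unliftP => [j|] -> /=.
rewrite big_ord_recl unlift_none /=; congr (_ + _)%MM.
by apply: eq_bigr => i _; rewrite liftK.
Qed.

Lemma ideal_pow_mon_span G m :
  ideal_pow (ideal_span [set f : {mpoly K[n]} | exists u, G u /\ f = 'X_[u]]) m =
  mon_ideal (fun v => exists2 us : 'I_m -> 'X_{1..n},
    (forall i, G (us i)) & (\sum_i us i <= v)%MM).
Proof.
rewrite mon_ideal_span /ideal_pow; set gens := (X in ideal_span X).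
have up : upclosed (fun v => exists2 us : 'I_m -> 'X_{1..n},
    (forall i, G (us i)) & (\sum_i us i <= v)%MM).
  move=> v w [us Gus /mnm_lepP uv]; exists us => //; apply/mnm_lepP => i.
  by rewrite mnmDE (leq_trans (uv i)) ?leq_addl.
apply/seteqP; split=> f.
  apply: ideal_span_sub => [|_ [g [Gg ->]] v]; first exact: mon_ideal_is_ideal.
  case/msupp_prod => vs vsg ->.
  have /choice[us us_vs] i : exists u, G u /\ (u <= vs i)%MM.
    by have [u Gu uv] := Gg i _ (vsg i); exists u.
  exists us => [i|]; first by case: (us_vs i).
  apply/mnm_lepP => i; rewrite !mnm_sumE leq_sum // => j _.
  by have [_ /mnm_lepP] := us_vs j.
apply: mon_ideal_sub => [|v [us Gus usv]]; first exact: ideal_span_is_ideal.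
have [_ _ spanM] := ideal_span_is_ideal gens.
rewrite -(submK usv) mpolyXD; apply/spanM/ideal_span_incl.
exists (fun i => 'X_[us i]); split; last first.
  exact: (big_morph (@mpolyX n K) (@mpolyXD n K) (@mpolyX0 n K)).
by move=> i; apply/mon_idealX; exists (us i) => //; apply: lepm_refl.
Qed.

End MonomialPowers.

(** * Sums of natural numbers over intervals *)

Section NatSums.
Local Open Scope nat_scope.
Implicit Types f g p bd : nat -> nat.

Lemma sum_nat_split f a m c : a <= m <= c ->
  \sum_(a <= x < c) f x = \sum_(a <= x < m) f x + \sum_(m <= x < c) f x.
Proof. by case/andP=> am mc; rewrite (big_cat_nat am mc). Qed.

Lemma leq_term_sum_nat f a x c : a <= x < c -> f x <= \sum_(a <= y < c) f y.
Proof.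
case/andP=> ax xc; rewrite (@sum_nat_split f a x); last by rewrite ax ltnW.
by rewrite (big_ltn xc); lia.
Qed.

Lemma leq_sum_nat f g a c : (forall x, a <= x < c -> f x <= g x) ->
  \sum_(a <= x < c) f x <= \sum_(a <= x < c) g x.
Proof.
move=> fg; rewrite big_nat_cond [leqRHS]big_nat_cond leq_sum // => x.
by rewrite andbT => /fg.
Qed.

Lemma sum_nat_delta i a c : \sum_(a <= x < c) (i == x) = (a <= i < c).
Proof.
elim: c => [|c IHc]; first by rewrite big_geq //; lia.
have [ac|ca] := leqP a c; last by rewrite big_geq; lia.
by rewrite big_nat_recr //= IHc; lia.
Qed.

Lemma sum_nat_addl i f a c :
  \sum_(a <= x < c) ((i == x) + f x) = (a <= i < c) + \sum_(a <= x < c) f x.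
Proof. by rewrite big_split sum_nat_delta. Qed.

Lemma leq_path p a c : a <= c ->
  (forall x, a <= x < c -> p x <= p x.+1) -> p a <= p c.
Proof.
elim: c => [|c IHc] ac pm; first by move: ac; rewrite leqn0 => /eqP->.
have [ac'|] := leqP a c; last by move=> ca; have -> : c.+1 = a by lia.
by apply: leq_trans (pm c _); [apply: IHc => // x xc; apply: pm|]; lia.
Qed.

(** Fill the boxes from the left: [C x] is the room before x, and u is the increment of min(s, C
    x). *)
Lemma box_sum bd m l s : m <= l -> s <= \sum_(m <= x < l) bd x ->
  exists u, (forall x, m <= x -> u x <= bd x) /\ \sum_(m <= x < l) u x = s.
Proof.
move=> ml sc; pose C x := \sum_(m <= y < x) bd y.
exists (fun x => minn s (C x.+1) - minn s (C x)); split=> [x mx|].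
  by rewrite /C big_nat_recr //=; lia.
rewrite (@telescope_sumn_in m l (fun x => minn s (C x))) //.
  by rewrite {2}/C big_geq // minn0 subn0; apply/minn_idPl.
by move=> x /andP[mx _]; rewrite /C big_nat_recr //=; lia.
Qed.

(* Hermite's identity: the sum of floor(a + i/s) is floor(s a), with a = p / s *)
Lemma sum_divn_shift (s p : nat) : 0 < s -> \sum_(0 <= i < s) (p + i) %/ s = p.
Proof.
move=> s0; elim: p => [|p IHp].
  by rewrite big_nat big1 // => i /andP[_ si]; rewrite add0n divn_small.
(* Peel first the last term, then the first term off the same sum of s + 1 terms; the quotient of p
   + s by s exceeds that of p by one. *)
have : \sum_(0 <= i < s.+1) (p + i) %/ s = p + (p + s) %/ s.
  by rewrite big_nat_recr //= IHp.
rewrite big_nat_recl //= addn0 divnDr // divnn s0.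
under eq_bigr => i _ do rewrite addnS -addSn.
by lia.
Qed.

End NatSums.

(** * Variable sets of associated primes for a system of interval inequalities *)

Section Constraints.
Local Open Scope nat_scope.
Variables (n k d : nat) (L beta b : nat -> nat).
Implicit Types (f g w : nat -> nat) (B : pred nat).

Let bs := \sum_(k <= x < n) b x.

(** Variables are numbered from 0, so x_{j+1}, ..., x_t have the indices j <= x < t. Later [beta 0]
    is 0 and [L] is alpha with its last entry raised, all data being scaled by s. *)
Definition feasible f :=
  (forall j t, j < t <= k -> L t <= beta j + \sum_(j <= x < t) f x) /\
  (forall j, j <= k -> d <= beta j + \sum_(j <= x < k) f x
                            + \sum_(k <= x < n) minn (f x) (b x)).

(** [mon_assoc] for feasible exponents, with functions on [nat] in place of multi-indices. *)
Definition extremal B := exists f,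
  (forall w, (forall x, x < n -> B x -> w x = 0) ->
     ~ feasible (fun x => w x + f x)) /\
  (forall i, i < n -> B i -> feasible (fun x => (i == x) + f x)).

(** The conditions allow prefix sums p that rise from [beta j] at j to L t - 1 at t with L a <= p a
    < beta a in between. Then the inequality for (j, t) fails by exactly one, and those for other
    pairs hold. *)
Definition head_type B j t :=
  [/\ j < t <= k, forall x, x < n -> B x = (j <= x < t), beta j < L t &
      forall a, j < a < t -> [/\ L a < beta a, beta j < beta a & L a < L t]].

Let bout B := \sum_(k <= x < n) ~~ B x * b x.

Definition tail_card B := \sum_(k <= x < n) B x.

(* The part of [tail_type] that is invariant under scaling *)
Definition tail_shape B j :=
  [/\ j <= k, forall x, x < k -> B x = (j <= x), 0 < tail_card B,
      beta j + bout B < d &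
      forall a, j < a <= k -> [/\ L a < beta a, beta j < beta a & L a + bout B < d]].

(** A variable of [B] with index at least k must stay below its cap, so a total of d - 1 is at most
    p_k + bs - [tail_card B], where the prefix sum p_k is [beta k] if j = k and smaller than
    [beta k] otherwise. *)
Definition tail_type B j :=
  tail_shape B j /\ tail_card B <= (beta k + bs - d) + (j == k).

Hypothesis k_lt_n : k < n.

Lemma feasible_le f g :
  (forall x, x < n -> f x <= g x) -> feasible f -> feasible g.
Proof.
move=> fg [f1 f2]; split=> [j t jt|j jk].
  apply: leq_trans (f1 _ _ jt) _; rewrite leq_add2l leq_sum_nat // => x xt.
  by apply: fg; lia.
apply: leq_trans (f2 _ jk) _; rewrite leq_add // ?leq_add2l leq_sum_nat // => x xt.
  by apply: fg; lia.
have := fg x; lia.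
Qed.

Lemma sum_minn_add i f : \sum_(k <= x < n) minn ((i == x) + f x) (b x)
  = (k <= i < n) && (f i < b i) + \sum_(k <= x < n) minn (f x) (b x).
Proof.
transitivity (\sum_(k <= x < n) (((i == x) && (f x < b x)) + minn (f x) (b x))).
  by apply: eq_bigr => x _; lia.
rewrite big_split /=; congr addn.
have [fb|fb] := boolP (f i < b i).
  rewrite andbT -sum_nat_delta; apply: eq_bigr => x _.
  by case: eqP => // <-; rewrite fb.
by rewrite andbF big1 // => x _; case: eqP => //= <-; rewrite (negbTE fb).
Qed.

Hypothesis k_gt0 : 0 < k.
Hypothesis L_mono : forall i j, 0 < i -> i <= j <= k -> L i <= L j.
Hypothesis L_beta : forall i, 0 < i <= k -> L i <= beta i.
Hypothesis b_gt0 : forall x, k <= x < n -> 0 < b x.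
Hypothesis d_L : d <= L k + bs.

(** Huge exponents off [B] satisfy the head inequalities they enter and fill the caps in the others.
    Some inequality still fails, and each variable of [B] repairs it; so it fails by exactly one,
    and [B] consists of the variables that can still raise its right-hand side. *)
Lemma extremal_types B : extremal B ->
  (exists j t, head_type B j t) \/ (exists j, tail_type B j).
Proof.
case=> f [fout fin].
pose N := d + bs + \sum_(0 <= x < k.+1) L x.
pose w x := ~~ B x * N.
pose V x := w x + f x.
have VN x : ~~ B x -> N <= V x by rewrite /V /w => ->; lia.
have LN t : t <= k -> L t <= N.
  by move=> tk; have := @leq_term_sum_nat L 0 t k.+1; rewrite /N; lia.
have Vout : ~ feasible V.
  by apply: fout => x xn Bx; rewrite /w Bx.
have Vin i : i < n -> B i -> feasible (fun x => (i == x) + V x).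
  by move=> lin /(fin i lin); apply: feasible_le => x _; rewrite /V; lia.
have V1 i j t : i < n -> B i -> j < t <= k ->
    L t <= beta j + ((j <= i < t) + \sum_(j <= x < t) V x).
  by move=> lin Bi jt; rewrite -sum_nat_addl; apply: (Vin i lin Bi).1.
have V2 i j : i < n -> B i -> j <= k ->
    d <= beta j + ((j <= i < k) + \sum_(j <= x < k) V x)
         + (((k <= i < n) && (V i < b i)) + \sum_(k <= x < n) minn (V x) (b x)).
  by move=> lin Bi jk; rewrite -sum_nat_addl -sum_minn_add; apply: (Vin i lin Bi).2.
have Vterm x a c : a <= x < c -> V x <= \sum_(a <= y < c) V y.
  exact: leq_term_sum_nat.
have Vsplit a m c : a <= m <= c -> \sum_(a <= x < c) V x
    = \sum_(a <= x < m) V x + \sum_(m <= x < c) V x by exact: sum_nat_split.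
have [[j [t [jt viol]]]|noviol] := pselect (exists j t,
    j < t <= k /\ beta j + \sum_(j <= x < t) V x < L t).
  left; exists j, t.
  have BE x : x < n -> B x = (j <= x < t).
    move=> xn; apply/idP/idP => [Bx|xjt]; first by have := V1 x j t xn Bx jt; lia.
    apply: contraT => /VN; have := Vterm x j t xjt; have := LN t; lia.
  have Bj : B j by rewrite BE; lia.
  have Bt : B t.-1 by rewrite BE; lia.
  split=> // [|a jat]; first by lia.
  have lj : j < n by lia.
  have lt1 : t.-1 < n by lia.
  (* Raising j leaves the sum over [a, t) unchanged and raising t - 1 the one over [j, a), so these
     two inequalities hold for [V] already. They squeeze beta j + V[j, a) between L a and beta a -
     1. *)
  have := V1 j a t lj Bj; have := V1 t.-1 j a lt1 Bt; have := Vsplit j a t.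
  by split; lia.
have noV1 j t : j < t <= k -> L t <= beta j + \sum_(j <= x < t) V x.
  by move=> jt; rewrite leqNgt; apply/negP => viol; apply: noviol; exists j, t.
have [j [jk viol]] : exists j, j <= k /\ beta j + \sum_(j <= x < k) V x
    + \sum_(k <= x < n) minn (V x) (b x) < d.
  apply: contrapT => noviol2; apply: Vout; split=> // j jk; rewrite leqNgt.
  by apply/negP => viol; apply: noviol2; exists j.
right; exists j.
set T := \sum_(k <= x < n) minn (V x) (b x) in V2 viol.
have bN x : k <= x < n -> b x <= N.
  by move=> xk; have := @leq_term_sum_nat b k x n xk; rewrite /N -/bs; lia.
have BE x : x < k -> B x = (j <= x).
  move=> xk; apply/idP/idP => [Bx|xj]; first by have := V2 x j _ Bx jk; lia.
  apply: contraT => /VN; have := Vterm x j k; rewrite /N; lia.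
have Tout : bout B <= T.
  apply: leq_sum_nat => x xk; case: (boolP (B x)) => //= Bx.
  by have := VN x Bx; have := bN x xk; lia.
(* A tail index of [B] lies strictly below its cap, since raising it must increase the capped
   sum. *)
have TB : T + tail_card B <= bs.
  rewrite -big_split; apply: leq_sum_nat => x xk /=.
  case: (boolP (B x)) => //= Bx; last by lia.
  by have := V2 x j _ Bx jk; lia.
(* Otherwise the tail is filled to [bs], and d <= L k + bs turns the failing inequality into one
   about [L k] that holds. *)
have [x0 x0k Bx0] : exists2 x0, k <= x0 < n & B x0.
  apply: contrapT => noB.
  have bT : bs <= T.
    apply: leq_sum_nat => x xk; have [Bx|Bx] := boolP (B x).
      by case: noB; exists x.
    by have := VN x Bx; have := bN x xk; lia.
  have [jk'|] := ltnP j k; first by have := noV1 j k; lia.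
  move=> kj; have jE : j = k by lia.
  by have := @L_beta k; move: viol; rewrite jE; lia.
have x0n : x0 < n by lia.
have tot := V2 x0 j x0n Bx0 jk.
have cardB : 0 < tail_card B.
  by have := @leq_term_sum_nat (fun x => B x : nat) k x0 n x0k; rewrite Bx0.
(* As for heads: raising [x0] does not affect the sum over [j, a), and raising j does not affect the
   sums from a on. *)
have main a : j < a <= k -> [/\ L a <= beta j + \sum_(j <= x < a) V x,
    beta j + \sum_(j <= x < a) V x < beta a &
    \sum_(j <= x < k) V x = \sum_(j <= x < a) V x + \sum_(a <= x < k) V x].
  move=> ja; have Bj : B j by rewrite BE; lia.
  have jn : j < n by lia.
  have := V1 x0 j a x0n Bx0 ja; have := V2 j a jn Bj; have := Vsplit j a k.
  by split; lia.
split; last first.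
  have [kj|jk'] := leqP k j.
    have jE : j = k by lia.
    by move: tot viol; rewrite jE eqxx big_geq //; lia.
  have jkk : j < k <= k by lia.
  by have [m1 m2 m3] := main k jkk; lia.
split=> // [|a ja]; first by lia.
by have [m1 m2 m3] := main a ja; split; lia.
Qed.

Lemma head_type_extremal B j t : head_type B j t -> extremal B.
Proof.
case=> jt BE bL C1'.
have C1 a : j < a < t -> (L a < beta a) && (beta j < beta a) && (L a < L t).
  by case/C1' => -> -> ->.
pose N := d + bs + \sum_(0 <= x < k.+1) L x.
have LN c : c <= k -> L c <= N.
  by move=> ck; have := @leq_term_sum_nat L 0 c k.+1; rewrite /N; lia.
(* The lowest admissible path of prefix sums; [f] is its increments on [j, t) and huge elsewhere. *)
pose p a := if a == j then beta j else if a == t then (L t).-1 else maxn (beta j) (L a).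
have pm x : j <= x < t -> p x <= p x.+1.
  move=> xt; rewrite /p.
  have := @L_mono x x.+1; have := C1 x; have := C1 x.+1.
  by case: (x =P j); case: (x.+1 =P j); case: (x =P t); case: (x.+1 =P t); lia.
pose f x := if j <= x < t then p x.+1 - p x else N.
have fN x : ~~ (j <= x < t) -> f x = N by rewrite /f => /negbTE->.
have fsum a c : j <= a <= c -> c <= t ->
    \sum_(a <= x < c) f x = p c - p a /\ p a <= p c.
  move=> ac ct; split; last by apply: leq_path => [|x xc]; [|apply: pm]; lia.
  rewrite -telescope_sumn_in; [|lia|by move=> x xc; apply: pm; lia].
  by apply: eq_big_nat => x xc; rewrite /f ifT //; lia.
have pj : p j = beta j by rewrite /p eqxx.
have pt : p t = (L t).-1 by rewrite /p eqxx ifF //; lia.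
have pa a : j < a < t -> L a <= p a < beta a.
  by move=> ja; have := C1 a ja; rewrite /p; case: (a =P j); case: (a =P t); lia.
exists f; split=> [w w0 [/(_ j t jt)]|i lin Bi].
  suff -> : \sum_(j <= x < t) (w x + f x) = (L t).-1 - beta j by lia.
  rewrite -pt -pj -(fsum j t _ _).1; try lia.
  by apply: eq_big_nat => x xt; rewrite w0 ?BE; lia.
have ijt : j <= i < t by rewrite -BE.
have F1 a c : a < c <= k -> L c <= beta a + \sum_(a <= x < c) ((i == x) + f x).
  move=> ac; rewrite sum_nat_addl.
  have [aj|ja] := ltnP a j.
    by have := @leq_term_sum_nat f a a c; have := LN c; have := fN a; lia.
  have [tc|ct] := ltnP t c.
    by have := @leq_term_sum_nat f a c.-1 c; have := LN c; have := fN c.-1; lia.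
  have jac : j <= a <= c by lia.
  have [-> pac] := fsum a c jac ct; have [aE|aj] := eqVneq a j; have [cE|ct'] := eqVneq c t.
  - by rewrite aE cE pj pt; lia.
  - by have := pa c; rewrite aE pj; lia.
  - by have := pa a; rewrite cE pt; lia.
  - by have := pa a; have := pa c; lia.
split=> // a ak.
have bT : bs <= \sum_(k <= x < n) minn ((i == x) + f x) (b x).
  apply: leq_sum_nat => x xk; rewrite fN; last by lia.
  by have := @leq_term_sum_nat b k x n xk; rewrite /N -/bs; lia.
have [ak'|ka] := ltnP a k; first by have := F1 a k; lia.
have -> : a = k by lia.
by have := @L_beta k; lia.
Qed.

Lemma tail_type_extremal B j : tail_type B j -> extremal B.
Proof.
case=> -[jk BE cardB bB C2'] cardle.
have C2 a : j < a <= k ->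
    (L a < beta a) && (beta j < beta a) && (L a + bout B < d).
  by case/C2' => -> -> ->.
pose N := d + bs + \sum_(0 <= x < k.+1) L x.
have LN c : c <= k -> L c <= N.
  by move=> ck; have := @leq_term_sum_nat L 0 c k.+1; rewrite /N; lia.
(* The most that the tail variables of [B] can carry while each stays below its cap. *)
pose A := \sum_(k <= x < n) B x * (b x).-1.
have AE : A + tail_card B + bout B = bs.
  rewrite -!big_split; apply: eq_big_nat => x xk /=.
  by have := b_gt0 xk; case: (B x); lia.
(* For j < k, the least value that is at least [beta j] and [L k] and leaves a remainder to d - 1
   that the full tail variables off [B] and [A] can absorb. *)
pose pk := if j == k then beta k else maxn (maxn (beta j) (L k)) (d.-1 - bout B - A).
have [pk1 pk2 pk3 pk4] : [/\ beta j <= pk, (j < k -> L k <= pk < beta k),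
    pk + bout B < d & d.-1 - bout B - pk <= A].
  rewrite /pk; have [jE|jk'] := eqVneq j k.
    by have := @L_beta k; move: cardle bB; rewrite jE eqxx; split; lia.
  move: cardle; rewrite (negbTE jk') => cardle.
  by have := C2 k; have := @L_beta k; split; lia.
have [u [ub usum]] := box_sum (ltnW k_lt_n) pk4.
pose p a := if a == j then beta j else if a == k then pk else maxn (beta j) (L a).
have pm x : j <= x < k -> p x <= p x.+1.
  move=> xt; rewrite /p.
  have := @L_mono x x.+1; have := @L_mono x k.
  by case: (x =P j); case: (x.+1 =P j); case: (x =P k); case: (x.+1 =P k); lia.
pose f x := if x < j then N else if x < k then p x.+1 - p x else if B x then u x else b x.
have fN x : x < j -> f x = N by rewrite /f => ->.
have fT x : k <= x -> f x = if B x then u x else b x.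
  by move=> kx; rewrite /f ltnNge (leq_trans jk kx) ltnNge kx.
have fsum a c : j <= a <= c -> c <= k ->
    \sum_(a <= x < c) f x = p c - p a /\ p a <= p c.
  move=> ac ct; split; last by apply: leq_path => [|x xc]; [|apply: pm]; lia.
  rewrite -telescope_sumn_in; [|lia|by move=> x xc; apply: pm; lia].
  by apply: eq_big_nat => x xc; rewrite /f ifF ?ifT //; lia.
have pj : p j = beta j by rewrite /p eqxx.
have pkE : p k = pk by rewrite /p eqxx; case: (k =P j) => // kj; rewrite /pk kj eqxx.
have pa a : j < a <= k -> L a <= p a < beta a.
  move=> ja; have := C2 a ja; rewrite /p; have [aE|aj] := eqVneq a j; first by lia.
  by have [->|ak] := eqVneq a k; lia.
have T w : (forall x, x < n -> B x -> w x = 0) ->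
    \sum_(k <= x < n) minn (w x + f x) (b x) = d.-1 - pk.
  move=> w0; transitivity (\sum_(k <= x < n) (u x + ~~ B x * b x)).
    apply: eq_big_nat => x xk; rewrite fT; last by lia.
    have ux := ub x; have xn : x < n by lia.
    have [Bx|Bx] := boolP (B x); last first.
      by rewrite (negbTE Bx) mul0n in ux; rewrite mul1n; lia.
    by rewrite Bx mul1n in ux; rewrite w0 // mul0n; lia.
  by rewrite big_split /= usum -/(bout B); lia.
exists f; split=> [w w0 [_ /(_ j jk)]|i lin Bi].
  rewrite T //; suff -> : \sum_(j <= x < k) (w x + f x) = pk - beta j by lia.
  rewrite -pkE -pj -(fsum j k _ _).1; try lia.
  by apply: eq_big_nat => x xt; rewrite w0 ?BE; lia.
have ij : j <= i.
  by have [ik|ik] := ltnP i k; [rewrite -BE|lia].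
split=> [a c ac|a ak].
  rewrite sum_nat_addl; have [aj|ja] := ltnP a j.
    by have := @leq_term_sum_nat f a a c; have := LN c; have := fN a; lia.
  have jac : j <= a <= c by lia.
  have ck : c <= k by lia.
  have [-> pac] := fsum a c jac ck; have [aE|aj] := eqVneq a j.
    by have := pa c; rewrite aE pj; lia.
  by have := pa a; have := pa c; lia.
rewrite sum_nat_addl sum_minn_add; have [aj|ja] := ltnP a j.
  by have := @leq_term_sum_nat f a a k; have := fN a; rewrite /N; lia.
have -> : \sum_(k <= x < n) minn (f x) (b x) = d.-1 - pk.
  by rewrite -(T (fun=> 0)).
have jak : j <= a <= k by lia.
have [-> pac] := fsum a k jak (leqnn k); rewrite pkE in pac *.
have [aE|aj] := eqVneq a j; last by have := pa a; lia.
rewrite aE pj.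
suff : k <= i -> f i < b i by lia.
move=> ki; rewrite fT // Bi.
by have := ub i ki; have := @b_gt0 i; rewrite Bi; lia.
Qed.

Lemma extremalP B :
  extremal B <-> (exists j t, head_type B j t) \/ (exists j, tail_type B j).
Proof.
split; first exact: extremal_types.
case=> [[j [t]]|[j]]; [exact: head_type_extremal|exact: tail_type_extremal].
Qed.

End Constraints.

(** * The inequalities for powers of a right PLP-polymatroidal ideal *)

Section RightPLP.
Local Open Scope nat_scope.
Variables (n k d : nat) (alpha beta b : nat -> nat).
Hypothesis hdata : right_PLP_data n k d alpha beta b.
Implicit Types (f g w : nat -> nat) (B : pred nat).

(* [beta_0 = 0], and the last lower bound also accounts for the fact that the
   variables x_{k+1}, ..., x_n contribute at most [bsum b k n]. *)
Let beta0 i := if i is 0 then 0 else beta i.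
Let L i := if i < k then alpha i else maxn (alpha k) (d - bsum b k n).
Let bb x := b x.+1.
Let bs := \sum_(k <= x < n) bb x.

Let k_gt0 : 0 < k := plp_k_gt0 hdata.
Let k_lt_n : k < n.
Proof. by have := plp_k_gt0 hdata; have := plp_k_lt hdata; lia. Qed.

Let bsumE : bsum b k n = bs.
Proof. by rewrite /bsum big_add1. Qed.

Let d_le : d <= beta k + bs.
Proof. by rewrite -bsumE; exact: plp_d_le hdata. Qed.

Let L_mono i j : 0 < i -> i <= j <= k -> L i <= L j.
Proof.
move=> i0 ij; have := plp_alpha_mono hdata i0 ij.
have ik : i <= k <= k by lia.
have := plp_alpha_mono hdata i0 ik.
by rewrite /L; case: (ltnP i k); case: (ltnP j k); lia.
Qed.

Let beta0_mono i j : i <= j <= k -> beta0 i <= beta0 j.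
Proof. by case: i => // i; case: j => // j ij; apply: (plp_beta_mono hdata). Qed.

Let L_beta i : 0 < i <= k -> L i <= beta0 i.
Proof.
case: i => // i ik; have := plp_alpha_beta hdata ik; rewrite /L /= bsumE.
case: (ltnP i.+1 k) => // ki; have -> : i.+1 = k by lia.
by lia.
Qed.

Let bb_gt0 x : k <= x < n -> 0 < bb x.
Proof. by move=> xk; apply: (plp_b_gt0 hdata). Qed.

Let d_L : d <= L k + bs.
Proof. by rewrite /L ltnn bsumE; lia. Qed.

Definition scaled_feasible s :=
  feasible n k (s * d) (fun i => s * L i) (fun i => s * beta0 i) (fun x => s * bb x).

Let sum_mul s : \sum_(k <= x < n) s * bb x = s * bs.
Proof. by rewrite -big_distrr. Qed.

Definition excess := beta k + bsum b k n - d.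

Definition scaled_types s B :=
  (exists j t, head_type n k L beta0 B j t) \/
  (exists j, tail_shape n k d L beta0 bb B j /\
             tail_card n k B <= s * excess + (j == k)).

Lemma scaled_extremalP s B : 0 < s ->
  extremal n k (s * d) (fun i => s * L i) (fun i => s * beta0 i)
    (fun x => s * bb x) B <-> scaled_types s B.
Proof.
move=> s0; rewrite extremalP //.
- have bE : \sum_(k <= x < n) ~~ B x * (s * bb x)
      = s * \sum_(k <= x < n) ~~ B x * bb x.
    by rewrite big_distrr /=; apply: eq_bigr => x _; rewrite mulnCA.
  have betaE : beta0 k = beta k by case: (k) k_gt0.
  split=> -[[j [t [jt BE bL C]]]|[j [[jk BE card0 bB C] card]]].
  + left; exists j, t; split=> // [|a ja]; first by move: bL; rewrite ltn_pmul2l.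
    by have := C a ja; rewrite !ltn_pmul2l.
  + right; exists j; split; first split=> // [|a ja].
    * by move: bB; rewrite bE -mulnDr ltn_pmul2l.
    * by have := C a ja; rewrite bE -mulnDr !ltn_pmul2l.
    * by move: card; rewrite sum_mul -mulnDr -mulnBr betaE /excess bsumE.
  + left; exists j, t; split=> // [|a ja]; first by rewrite ltn_pmul2l.
    by have := C a ja; rewrite !ltn_pmul2l.
  + right; exists j; split; first split=> // [|a ja].
    * by rewrite bE -mulnDr ltn_pmul2l.
    * by have := C a ja; rewrite bE -mulnDr !ltn_pmul2l.
    * by rewrite sum_mul -mulnDr -mulnBr betaE -bsumE.
- by move=> i j i0 ij; rewrite leq_pmul2l // L_mono.
- by move=> i ik; rewrite leq_pmul2l // L_beta.
- by move=> x xk; rewrite muln_gt0 s0 bb_gt0.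
- by rewrite sum_mul -mulnDr leq_pmul2l // d_L.
Qed.

Let delta : nat := alpha k == beta k.

(** There are only n - k tail indices. A tail shape with j < k has L k < beta k, hence delta = 0;
    for j = k the extra 1 covers delta. So the cardinality bound is vacuous once m * [excess]
    reaches n - k - delta. *)
Lemma scaled_types_stable m l B : n - k - delta <= m * excess \/ excess = 0 ->
  m <= l -> scaled_types m B <-> scaled_types l B.
Proof.
move=> mN ml; split=> -[H|[j [sh card]]]; [by left|right|by left|right].
  exists j; split=> //; apply: leq_trans card _; rewrite leq_add2r.
  by rewrite leq_mul2r ml orbT.
exists j; split=> //; case: mN => [mN|e0]; last by move: card; rewrite e0; lia.
have card_le : tail_card n k B <= n - k.
  rewrite -[n - k]muln1 -sum_nat_const_nat; apply: leq_sum_nat => x _.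
  by case: (B x).
case: sh => jk _ _ _ C; have [jE|jk'] := eqVneq j k.
  by have : delta <= 1; [exact: leq_b1|lia].
have jkk : j < k <= k by lia.
have [Lb _ _] := C k jkk; move: mN; rewrite /delta.
have -> : (alpha k == beta k) = false.
  apply/negP => /eqP ab; move: Lb; rewrite /L ltnn ab.
  by rewrite /beta0; case: (k) k_gt0 => // k' _; lia.
lia.
Qed.

Lemma scaled_types_unstable m : 0 < m -> 0 < excess -> m * excess < n - k - delta ->
  exists B, ~ scaled_types m B /\ exists2 l, m <= l & scaled_types l B.
Proof.
move=> m0 e0 mN.
have betaE : beta0 k = beta k by case: (k) k_gt0.
have beta_gt0 : 0 < beta k.
  apply: leq_trans (plp_beta_gt0 hdata) _; apply: (plp_beta_mono hdata) => //.
  by rewrite k_gt0 leqnn.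
have bd := plp_beta_d hdata; have ad := plp_alpha_d hdata.
have ab : alpha k <= beta k by apply: (plp_alpha_beta hdata); rewrite k_gt0 leqnn.
have n_bs : n - k <= bs.
  rewrite -[n - k]muln1 -sum_nat_const_nat; apply: leq_sum_nat => x xk.
  exact: bb_gt0.
(* If alpha_k = beta_k, no j < k gives a tail shape, so j = k. Otherwise take j maximal with beta_j
   < beta_k: all later beta_a equal beta_k, which exceeds [L k] because [excess] is positive. *)
have [j [jk jd jb jC]] : exists j, [/\ j <= k, (j == k) = (delta == 1) :> bool,
    beta0 j < d & forall a, j < a <= k ->
      [/\ L a < beta0 a, beta0 j < beta0 a & L a < d]].
  have [abE|abE] := eqVneq (alpha k) (beta k).
    exists k; rewrite /delta abE !eqxx; split=> // [|a]; last by lia.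
    (* Here beta_k < d, since [excess] <= m * [excess] < n - k - 1 < bs. *)
    have := leq_pmull excess m0; move: mN; rewrite /delta abE eqxx betaE.
    rewrite /excess bsumE; lia.
  have [|i ik|j /andP[jk jb] jmax] := @ex_maxnP (fun j => (j < k) && (beta0 j < beta0 k)) k.
  - by exists 0; rewrite k_gt0 betaE.
  - by lia.
  exists j; rewrite /delta (negbTE abE) /=; split; try lia.
  move=> a ja; have ba : beta0 a = beta0 k.
    have [->//|ak] := eqVneq a k.
    by have := @beta0_mono a k; have := jmax a; lia.
  have a0 : 0 < a by lia.
  have ak : a <= k <= k by lia.
  have := L_mono a0 ak; rewrite {2}/L ltnn ba betaE; move: e0.
  by rewrite /excess !bsumE; split; lia.
pose B x := j <= x.
have cardB : tail_card n k B = n - k.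
  rewrite -[n - k]muln1 -sum_nat_const_nat; apply: eq_big_nat => x xk.
  by rewrite /B; case: leqP => //; lia.
have boutB : \sum_(k <= x < n) ~~ B x * bb x = 0.
  rewrite big_nat big1 // => x xk; rewrite /B; case: leqP => //; lia.
exists B; split=> [[[i [t [it BE _ _]]]|[i [[ik BE _ _ _] card]]]|].
(* [B] contains k, so it is not of head type; its values below k determine j. *)
- by have := BE k k_lt_n; rewrite /B jk; lia.
- have ij : i = j.
    by have := BE i; have := BE j; rewrite /B; lia.
  by move: card; rewrite cardB ij jd; lia.
exists (m + n); first by lia.
right; exists j; split; last first.
  rewrite cardB; apply: leq_trans (leq_addr _ _).
  by apply: leq_trans (leq_pmulr _ e0); lia.
split=> //; rewrite ?cardB ?boutB ?addn0 //; first by lia.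
by move=> a ja; have [] := jC a ja; rewrite addn0.
Qed.

Lemma prefix_sumE (u : 'X_{1..n}) i : i <= n ->
  \sum_(j < n | j < i) u j = \sum_(0 <= x < i) nth 0 u x.
Proof.
move=> lin; rewrite big_mkord (big_ord_widen n) //.
by apply: eq_bigr => j _; rewrite (mnm_nth 0).
Qed.

(** For each summand, the sum over [j, t) is a difference of prefix sums, the first at least [L t]
    and the second at most [beta0 j]. *)
Lemma exponent_sum_feasible s (us : 'I_s -> 'X_{1..n}) f :
  (forall i, right_PLP_exponent k d alpha beta b (us i)) ->
  (forall x, x < n -> \sum_i nth 0 (us i) x <= f x) ->
  scaled_feasible s f.
Proof.
move=> Hus usf.
have mulE c : \sum_(i < s) c = s * c by rewrite sum_nat_const card_ord.
have head i a : a <= k -> \sum_(0 <= x < a) nth 0 (us i) x <= beta0 a.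
  case: a => [|a] ak; first by rewrite big_geq.
  have [/(_ a.+1) H _ _] := Hus i; move: (H ak) => /andP[_].
  by rewrite prefix_sumE //; lia.
have tail i x : k <= x < n -> nth 0 (us i) x <= bb x.
  move=> /andP[kx xn]; have [_ /(_ (Ordinal xn) kx) + _] := Hus i.
  by rewrite (mnm_nth 0).
have low i a : 0 < a <= k -> L a <= \sum_(0 <= x < a) nth 0 (us i) x.
  move=> ak; have [/(_ a ak) /andP[+ _] _ tot] := Hus i.
  rewrite prefix_sumE; last by lia.
  rewrite /L; case: (ltnP a k) => [//|ka]; have -> : a = k by lia.
  (* The tail of an exponent of degree d carries at most [bs], so the first k variables carry at
     least d - bs. *)
  move=> lo; rewrite geq_max lo -tot leq_subLR /=.
  rewrite (eq_bigl (fun j : 'I_n => j < n)) ?prefix_sumE // => [|j]; last first.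
    by rewrite ltn_ord.
  rewrite (@sum_nat_split _ 0 k n) ?leq0n ?(ltnW k_lt_n) // addnC bsumE.
  by rewrite leq_add2r; apply: leq_sum_nat => x xk; apply: tail.
have total i : \sum_(0 <= x < n) nth 0 (us i) x = d.
  have [_ _ <-] := Hus i; rewrite -prefix_sumE //.
  by apply: eq_bigl => j; rewrite ltn_ord.
have le_sum a c : c <= n ->
    \sum_(i < s) \sum_(a <= x < c) nth 0 (us i) x <= \sum_(a <= x < c) f x.
  by move=> cn; rewrite exchange_big; apply: leq_sum_nat => x xc; apply: usf; lia.
split=> [j t jt|j jk].
  rewrite -!mulE; apply: leq_trans (leq_add (leqnn _) (le_sum j t _)); last by lia.
  rewrite -big_split; apply: leq_sum => i _ /=.
  have := low i t; have := head i j.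
  by rewrite (@sum_nat_split _ 0 j t); lia.
have le_tail : \sum_(i < s) \sum_(k <= x < n) nth 0 (us i) x
    <= \sum_(k <= x < n) minn (f x) (s * bb x).
  rewrite exchange_big; apply: leq_sum_nat => x xk /=.
  rewrite leq_min usf; last by lia.
  by rewrite -mulE leq_sum // => i _; apply: tail.
have kn : k <= n by exact: ltnW.
apply: leq_trans (leq_add (leq_add (leqnn _) (le_sum j k kn)) le_tail).
rewrite -!mulE -!big_split; apply: leq_sum => i _ /=.
have := total i; have := head i j jk.
by rewrite (@sum_nat_split _ 0 j n) ?(@sum_nat_split _ j k n); lia.
Qed.

(* Greedy choice: the largest admissible prefix sums q_i. *)
Lemma feasible_point s f : scaled_feasible s f -> exists2 w : nat -> nat,
  (forall x, w x <= f x) &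
  [/\ forall i, 0 < i <= k -> s * alpha i <= \sum_(0 <= x < i) w x <= s * beta i,
      forall x, k <= x -> w x <= s * bb x
    & \sum_(0 <= x < n) w x = s * d].
Proof.
case=> f1 f2.
pose q := fix q i := if i is i'.+1 then minn (s * beta i) (q i' + f i') else 0.
have q_le i : q i <= s * beta0 i by case: i => //= i; rewrite geq_minl.
(* j is the last index at which the cap s * beta_j was attained, or 0; from there on [q] grows by f.
   This turns the inequalities for f into lower bounds on [q]. *)
have qE i : exists2 j, j <= i & q i = s * beta0 j + \sum_(j <= x < i) f x.
  elim: i => [|i [j ji qj]]; first by exists 0; rewrite ?big_geq //= muln0.
  have [le|ge] := leqP (s * beta i.+1) (q i + f i).
    by exists i.+1; rewrite ?big_geq //= addn0; apply/minn_idPl.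
  exists j; first exact: leqW.
  by rewrite big_nat_recr //= addnA -qj; apply/minn_idPr/ltnW.
have q_mono i : i < k -> q i <= q i.+1.
  move=> ik; rewrite /= leq_min leq_addr andbT (leq_trans (q_le i)) //.
  by rewrite leq_mul2l (@beta0_mono i i.+1) ?orbT //; lia.
have q_low t : 0 < t <= k -> s * L t <= q t.
  move=> tk; have [j jt ->] := qE t; have [jt'|tj] := ltnP j t.
    by apply: f1; lia.
  have -> : j = t by lia.
  by rewrite big_geq // addn0 leq_mul2l L_beta ?orbT.
have qd : q k <= s * d.
  apply: leq_trans (q_le k) _; rewrite leq_mul2l; case: (k) k_gt0 (plp_beta_d hdata).
    by [].
  by move=> k' _ ->; rewrite orbT.
(* What [q k] lacks must come from the tail; the second family of inequalities, at the index j of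
   [qE], provides it. *)
have tot : s * d - q k <= \sum_(k <= x < n) minn (f x) (s * bb x).
  by have [j jk ->] := qE k; have := f2 j jk; rewrite leq_subLR.
have [u [uf utot]] := box_sum (ltnW k_lt_n) tot.
pose w x := if x < k then q x.+1 - q x else u x.
have wq i : i <= k -> \sum_(0 <= x < i) w x = q i.
  move=> ik; rewrite -[q i]subn0 -[0 in RHS]/(q 0).
  rewrite -(@telescope_sumn_in 0 i q) // => [|x xi]; last by apply: q_mono; lia.
  by apply: eq_big_nat => x xi; rewrite /w ifT //; lia.
exists w => [x|].
  rewrite /w; case: ltnP => xk; last by have := uf x xk; lia.
  by rewrite leq_subLR geq_minr.
split=> [i ik|x xk|].
- rewrite wq; last by lia.
  apply/andP; split; last by case: i ik (q_le i).
  apply: leq_trans (q_low i ik); rewrite leq_mul2l; apply/orP; right.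
  by rewrite /L; case: ltnP => // ki; rewrite (_ : i = k) ?leq_maxl //; lia.
- by rewrite /w ltnNge xk /=; have := uf x xk; lia.
- rewrite (@sum_nat_split _ 0 k n) ?(ltnW k_lt_n) // wq //.
  rewrite (eq_big_nat _ _ (F2 := u)) => [|x xk]; first by rewrite utot subnKC.
  by rewrite /w ltnNge (andP xk).1.
Qed.

(* Rounding all prefix sums divided by s with the s shifts 0, 1/s, ..., (s-1)/s
   decomposes a point of the s-th dilate into s lattice points. *)
Lemma feasible_exponent_sum s f : 0 < s -> scaled_feasible s f ->
  exists2 us : 'I_s -> 'X_{1..n},
    (forall i, right_PLP_exponent k d alpha beta b (us i)) &
    forall x : 'I_n, \sum_i us i x <= f x.
Proof.
move=> s0 /feasible_point[w wf [w1 w2 w3]].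
pose P i := \sum_(0 <= x < i) w x.
have PS i : P i.+1 = P i + w i by rewrite /P big_nat_recr.
have P_mono (l i : nat) : (P i + l) %/ s <= (P i.+1 + l) %/ s.
  by rewrite leq_div2r // PS; lia.
pose us (l : 'I_s) : 'X_{1..n} :=
  [multinom (P x.+1 + l) %/ s - (P x + l) %/ s | x < n].
exists us => [l|x]; last first.
  under eq_bigr => l _ do rewrite mnmE.
  rewrite sumnB //.
  have divE p : \sum_(l < s) (p + l) %/ s = p.
    by rewrite -{2}(sum_divn_shift p s0) big_mkord.
  by rewrite !divE PS addKn.
have prefE i : i <= n -> \sum_(0 <= x < i) nth 0 (us l) x = (P i + l) %/ s.
  move=> lin; transitivity (\sum_(0 <= x < i) ((P x.+1 + l) %/ s - (P x + l) %/ s)).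
    apply: eq_big_nat => x xi; have xn : x < n by lia.
    by rewrite -[x]/(val (Ordinal xn)) -mnm_nth mnmE.
  rewrite (@telescope_sumn_in 0 i (fun x => (P x + l) %/ s)) //.
  by rewrite {2}/P big_geq // add0n (divn_small (ltn_ord l)) subn0.
have ls := ltn_ord l.
split=> [i ik|j kj|].
(* Both bounds on [P i] are multiples of s, so adding l < s before dividing does not carry past
   them. *)
- rewrite prefix_sumE ?prefE; try lia.
  have /andP[lo hi] := w1 i ik; apply/andP; split.
    by rewrite leq_divRL // mulnC (leq_trans lo) // leq_addr.
  by rewrite -ltnS ltn_divLR // mulSn [_ * s]mulnC; rewrite -/(P i) in hi; lia.
- rewrite mnmE PS leq_subLR.
  have -> : (P j + l) %/ s + b j.+1 = (b j.+1 * s + (P j + l)) %/ s.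
    by rewrite divnMDl // addnC.
  by apply: leq_div2r; have := w2 j kj; rewrite /bb mulnC; lia.
- rewrite (eq_bigl (fun j : 'I_n => j < n)) => [|j]; last by rewrite ltn_ord.
  rewrite prefix_sumE // prefE // /P w3 mulnC divnMDl //.
  by rewrite (divn_small ls) addn0.
Qed.

Lemma scaled_feasibleP s (v : 'X_{1..n}) : 0 < s ->
  (exists2 us : 'I_s -> 'X_{1..n},
    (forall i, right_PLP_exponent k d alpha beta b (us i)) &
    (\sum_i us i <= v)%MM) <-> scaled_feasible s (nth 0 v).
Proof.
move=> s0; split=> [[us Hus /mnm_lepP usv]|].
  apply: exponent_sum_feasible Hus _ => x xn.
  have := usv (Ordinal xn); rewrite mnm_sumE (mnm_nth 0) /=.
  by congr (_ <= _); apply: eq_bigr => i _; rewrite (mnm_nth 0).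
case/(feasible_exponent_sum s0) => us Hus usv; exists us => //.
by apply/mnm_lepP => x; rewrite mnm_sumE (mnm_nth 0).
Qed.

End RightPLP.

(** * Translating equality of Ass into equality of families of index sets *)

Section AssMonomial.
Variables (K : fieldType) (n : nat).
Implicit Types (M : 'X_{1..n} -> Prop) (B : pred nat).

Lemma mon_assoc_ext M B B' :
  (forall i : 'I_n, B i = B' i) -> mon_assoc M B -> mon_assoc M B'.
Proof.
move=> BB' [v [vout vin]]; exists v; split=> [w w0|i].
  by apply: vout => i; rewrite BB'; apply: w0.
by rewrite -BB'; apply: vin.
Qed.

(** Every associated prime is some [mon_prime B], and the prime determines [B] on the indices below
    n. *)
Lemma Ass_mon_idealP M M' : upclosed M -> upclosed M' ->
  Ass (mon_ideal M : set {mpoly K[n]}) = Ass (mon_ideal M') <->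
  (forall B, mon_assoc M B <-> mon_assoc M' B).
Proof.
move=> Mup Mup'; split=> [AE B|AE].
  have sub M1 M2 : upclosed M1 -> upclosed M2 ->
      Ass (mon_ideal M1 : set {mpoly K[n]}) = Ass (mon_ideal M2) ->
      mon_assoc M1 B -> mon_assoc M2 B.
    move=> up1 up2 E /(mon_assoc_Ass K up1); rewrite E => /(Ass_mon_assoc up2).
    by case=> B' /mon_prime_inj BB'; apply: mon_assoc_ext => i; rewrite BB'.
  by split; apply: sub.
apply/seteqP; split=> P.
  by case/(Ass_mon_assoc Mup) => B -> /AE/(mon_assoc_Ass K Mup').
by case/(Ass_mon_assoc Mup') => B -> /AE/(mon_assoc_Ass K Mup).
Qed.

(** Monotonicity makes [F] depend only on values below n, so multi-indices and functions on [nat]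
    are interchangeable. *)
Lemma mon_assoc_nat (F : (nat -> nat) -> Prop) B :
  (forall f g, (forall x, (x < n)%N -> (f x <= g x)%N) -> F f -> F g) ->
  mon_assoc (fun v : 'X_{1..n} => F (nth 0%N v)) B <->
  exists f : nat -> nat,
  (forall w : nat -> nat, (forall x, (x < n)%N -> B x -> w x = 0%N) ->
     ~ F (fun x => w x + f x)%N) /\
  (forall i, (i < n)%N -> B i -> F (fun x => (i == x) + f x)%N).
Proof.
move=> Fle.
have nthE (v : 'X_{1..n}) x (xn : (x < n)%N) : nth 0%N v x = v (Ordinal xn).
  by rewrite (mnm_nth 0).
split=> [[v [vout vin]]|[f [fout fin]]].
  exists (nth 0%N v); split=> [w w0 Fw|i lin Bi].
    apply: (vout [multinom w i | i < n]) => [i Bi|]; first by rewrite mnmE w0.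
    by apply: Fle Fw => x xn; rewrite !nthE mnmDE mnmE.
  apply: Fle (vin (Ordinal lin) Bi) => x xn.
  by rewrite !nthE mnmDE mnm1E.
exists [multinom f i | i < n]; split=> [w w0 Fw|i Bi].
  apply: (fout (nth 0%N w)) => [x xn Bx|]; first by rewrite nthE; apply: w0.
  by apply: Fle Fw => x xn; rewrite !nthE mnmDE mnmE.
apply: Fle (fin i (ltn_ord i) Bi) => x xn.
by rewrite nthE mnmDE mnmE mnm1E.
Qed.

End AssMonomial.

Lemma ceil_divn (N D : nat) : (0 < D)%N ->
  Num.ceil (N%:R / D%:R : rat) = ((N + D.-1) %/ D)%N%:Z.
Proof.
move=> D0; set c := ((N + D.-1) %/ D)%N.
have DQ : 0 < (D%:R : rat) by rewrite ltr0n.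
have cD : (N <= c * D < N + D)%N.
  have := divn_eq (N + D.-1) D; have := ltn_pmod (N + D.-1) D0; rewrite -/c; lia.
apply/ceil_def.
rewrite ltr_pdivlMr // ler_pdivrMr // rmorphB /= mulrBl mul1r ltrBlDr.
by rewrite -!pmulrn -!natrM -natrD ltr_nat ler_nat; lia.
Qed.

(** * Stability of the associated primes of powers, and the value of astab *)

Section RightPLPStability.
Variables (K : fieldType) (n k d : nat) (alpha beta b : nat -> nat).
Hypothesis hdata : right_PLP_data n k d alpha beta b.

Let I := right_PLP_ideal K n k d alpha beta b.
Let F s := scaled_feasible n k d alpha beta b s.
Let N := (n - k - (alpha k == beta k))%N.

Let F_le s f g : (forall x, (x < n)%N -> (f x <= g x)%N) -> F s f -> F s g.
Proof.
by apply: feasible_le; have := plp_k_gt0 hdata; have := plp_k_lt hdata; lia.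
Qed.

Lemma ideal_pow_right_PLP s : (0 < s)%N ->
  ideal_pow I s = mon_ideal (fun v => F s (nth 0%N v)).
Proof.
move=> s0; rewrite /I /right_PLP_ideal ideal_pow_mon_span.
by congr mon_ideal; apply/funext => v; apply/propext/scaled_feasibleP.
Qed.

Lemma Ass_pow_right_PLP m l : (0 < m)%N -> (0 < l)%N ->
  Ass (ideal_pow I m) = Ass (ideal_pow I l) <->
  (forall B, scaled_types n k d alpha beta b m B
             <-> scaled_types n k d alpha beta b l B).
Proof.
move=> m0 l0; rewrite !ideal_pow_right_PLP //.
have up s : upclosed (fun v : 'X_{1..n} => F s (nth 0%N v)).
  move=> v w; apply: F_le => x xn.
  rewrite -[x]/(val (Ordinal xn)) -!mnm_nth mnmDE leq_addl //.
have E s B : (0 < s)%N -> mon_assoc (fun v : 'X_{1..n} => F s (nth 0%N v)) B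
    <-> scaled_types n k d alpha beta b s B.
  move=> s0; rewrite -(scaled_extremalP hdata B s0); apply: mon_assoc_nat.
  exact: F_le.
rewrite Ass_mon_idealP //.
by split=> H B; have := H B; rewrite !E.
Qed.

Lemma right_PLP_astab : let e := excess n k d beta b in
  is_astab I (if e == 0%N then 1 else maxn 1 ((N + e.-1) %/ e)).
Proof.
move=> e; have [e0|e_gt0] := posnP e.
  split; last by move=> m' [].
  split=> // l l1; apply/(Ass_pow_right_PLP _ l1) => // B.
  by apply: scaled_types_stable => //; right.
set m := maxn 1 _; have m_gt0 : (0 < m)%N by rewrite leq_max.
(* So [m] is the least positive s with N <= s * e, the threshold of [scaled_types_stable] and
   [scaled_types_unstable]. *)
have le_m s : (m <= s)%N = (0 < s)%N && (N <= s * e)%N.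
  rewrite geq_max; congr andb; rewrite -ltnS ltn_divLR // mulSn.
  by apply/idP/idP; lia.
split; first split=> // l ml; last first.
  move=> m' [m'0 stab]; rewrite le_m m'0 /= leqNgt; apply/negP => m'N.
  have [B [nB [l ml lB]]] := scaled_types_unstable hdata m'0 e_gt0 m'N.
  apply/nB; have /Ass_pow_right_PLP E := stab l ml.
  by apply/E => //; apply: leq_trans ml.
have l_gt0 : (0 < l)%N by exact: leq_trans ml.
apply/Ass_pow_right_PLP => // B; apply: (scaled_types_stable hdata) => //.
by left; have := le_m m; rewrite leqnn => /esym/andP[].
Qed.

End RightPLPStability.

Theorem theorem6p14 (K : fieldType) (n k d : nat) (alpha beta b : nat -> nat)
    (hdata : right_PLP_data n k d alpha beta b) :
  let I := right_PLP_ideal K n k d alpha beta b in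
  let delta : int := Num.floor ((alpha k)%:R / (beta k)%:R : rat) in
  (d = (beta k + bsum b k n)%N -> is_astab I 1) /\
  ((d < beta k + bsum b k n)%N ->
   exists2 m : nat, is_astab I m &
     m%:Z = Num.max 1
              (Num.ceil ((n%:R - k%:R - delta%:~R)
                         / ((beta k)%:R + (bsum b k n)%:R - d%:R) : rat))).
Proof.
move=> I delta; have astab := right_PLP_astab K hdata.
have := plp_k_gt0 hdata; have := plp_k_lt hdata; move=> kn k0.
split=> [dE|d_lt].
  have e0 : excess n k d beta b = 0%N by rewrite /excess -dE subnn.
  by rewrite /= e0 eqxx in astab.
have e0 : (0 < excess n k d beta b)%N by rewrite /excess subn_gt0.
rewrite /= gtn_eqF // in astab; eexists; first exact: astab.
have k1 : (0 < k <= k)%N by rewrite k0 leqnn.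
have ab : (alpha k <= beta k)%N by exact: (plp_alpha_beta hdata).
have beta_gt0 : (0 < beta k)%N.
  by apply: leq_trans (plp_beta_gt0 hdata) _; apply: (plp_beta_mono hdata).
have bQ : 0 < ((beta k)%:R : rat) by rewrite ltr0n.
(* As 0 <= alpha_k <= beta_k and beta_k > 0, the floor is 1 in the case of equality and 0
   otherwise. *)
have deltaE : delta = (alpha k == beta k)%:Z.
  apply/floor_def; rewrite ler_pdivlMr // ltr_pdivrMr // rmorphD /=.
  rewrite -!pmulrn -natrD -!natrM ler_nat ltr_nat.
  by case: eqP ab => [->|]; lia.
(* Since delta <= 1 <= n - k, truncated subtraction agrees with the rational one. *)
have -> : n%:R - k%:R - delta%:~R = (n - k - (alpha k == beta k))%:R :> rat.
  by rewrite deltaE -pmulrn -!natrB //; lia.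
have -> : (beta k)%:R + (bsum b k n)%:R - d%:R = (excess n k d beta b)%:R :> rat.
  by rewrite -natrD -natrB // ltnW.
by rewrite ceil_divn //; lia.
Qed.
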